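(* Let $n\geq 2$ be an integer. Then $$\frac{\Delta(\Psi_n(x))}{\Delta(\Phi_n(x))}=\begin{cases}\dfrac{2^{\varphi(n)}}{p}&\text{if } n=p^\alpha \text{ for some prime } p \text{ and some positive integer } \alpha;\\[1ex] 2^{\varphi(n)}&\text{otherwise}.\end{cases}$$
   Context: The Fibonacci polynomials are defined by $F_1(x)=1$, $F_2(x)=x$, and $F_n(x)=xF_{n-1}(x)+F_{n-2}(x)$ for $n\geq 3$. For $n\geq 2$, the $n$-th fibotomic polynomial $\Psi_n(x)\in\mathbb{Z}[x]$ is the product of the monic irreducible factors of $F_n(x)$ which are not factors of $F_k(x)$ for any $k<n$; also $\Psi_1(x)=1$. For $n\ge2$, $\Psi_n$ is monic of degree $\varphi(n)$ (Euler's totient). $\Phi_n(x)$ is the $n$-th cyclotomic polynomial. $\Delta(f)$ denotes the discriminant of a monic polynomial $f$ with roots $r_1,\dots,r_d$, namely $\prod_{i<j}(r_i-r_j)^2$. *)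

(* Defs.v *)
From HB Require Import structures.
From Stdlib Require Import ClassicalEpsilon.
From mathcomp Require Import all_boot all_order all_algebra all_field.
Set Implicit Arguments. Unset Strict Implicit. Unset Printing Implicit Defensive.
Import Order.TTheory GRing.Theory Num.Theory.
Local Open Scope ring_scope.

Fixpoint fibpoly (n : nat) : {poly rat} :=
  match n with
  | 0 => 0
  | 1 => 1
  | (m.+1 as n1).+1 => 'X * fibpoly n1 + fibpoly m
  end.

Definition fibotomic_factors (n : nat) (s : seq {poly rat}) : Prop :=
  uniq s /\
  forall q : {poly rat},
    q \in s <-> [/\ q \is monic, irreducible_poly q, q %| fibpoly n
                  & forall k : nat, (0 < k < n)%N -> ~~ (q %| fibpoly k)].

Definition fibotomic (n : nat) : {poly rat} :=
  if (n <= 1)%N then 1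
  else \prod_(q <- epsilon (inhabits [::]) (fibotomic_factors n)) q.

(* Roots (with multiplicity) of a complex polynomial, and the discriminant
   prod_{i<j} (r_i - r_j)^2 of a monic polynomial *)
Definition croots (p : {poly algC}) : seq algC := sval (closed_field_poly_normal p).

Definition disc (p : {poly algC}) : algC :=
  let r := croots p in
  \prod_(i < size r) \prod_(j < size r | (i < j)%N) (r`_i - r`_j) ^+ 2.

(* Main.v *)
Require Import Defs.
From Stdlib Require ClassicalEpsilon.
From HB Require Import structures.
From mathcomp Require Import all_boot all_order all_algebra all_field.
From mathcomp Require Import ring zify.
Import Order.TTheory GRing.Theory Num.Theory.
Local Open Scope ring_scope.

(** For a primitive 2n-th root of unity w, the roots of F_n are the numbers
    x_k = i (w^k + w^-k) with 0 < k < n (substitute x = y - 1/y), and x_k is a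
    root of F_m iff n divides k m; hence the roots of Psi_n are the x_k with k
    coprime to n, while those of Phi_n are the z_k = w^(2k). Up to units
      x_j - x_k = (w^j - w^k) (w^(j+k) - 1)  and  z_j - z_k = (w^j - w^k) (w^j + w^k).
    Since w^(n-j) = - w^-j, the products of w^(j+k) - 1 and of w^j + w^k over all
    pairs (j, k), diagonal included, agree up to a unit. So the ratio of the
    discriminants is the inverse ratio of the diagonal products, which are
    2^phi(n) and Phi_n(1) up to units. Finally Phi_n(1) is p if n is a power of p,
    and 1 otherwise. *)

(** * Values of cyclotomic polynomials at 1 *)

(** Dividing [X^n - 1] by ['Phi_1 = X - 1] leaves a geometric sum of n terms, each equal to 1 at
    1. *)
Lemma prod_Cyclotomic_at1 (n : nat) : (0 < n)%N ->
  \prod_(d <- divisors n | d != 1%N) ('Phi_d).[1] = n%:R :> int.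
Proof.
move=> n_gt0.
have Phi1 : 'Phi_1 = 'X - 1 :> {poly int}.
  by rewrite -(expr1 'X) -(@prod_Cyclotomic 1) // big_seq1.
have: 'Phi_1 * \prod_(d <- divisors n | d != 1%N) 'Phi_d
    = ('X - 1) * \sum_(i < n) 'X^i :> {poly int}.
  by rewrite -subrX1 -prod_Cyclotomic // [RHS](bigD1_seq 1%N) ?divisor1 ?divisors_uniq.
rewrite Phi1 => /mulfI; rewrite polyXsubC_eq0 => /(_ isT)/(congr1 (horner^~ 1)).
rewrite horner_prod horner_sum => ->.
rewrite (eq_bigr (fun=> 1)) ?sumr_const ?card_ord // => i _.
by rewrite hornerXn expr1n.
Qed.

Lemma big_divisors_dvdn (m n : nat) (F : nat -> int) : (0 < n)%N -> (m %| n)%N ->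
  \prod_(d <- divisors n | (d != 1%N) && (d %| m)%N) F d =
  \prod_(d <- divisors m | d != 1%N) F d.
Proof.
move=> n_gt0 m_dv_n; have m_gt0 := dvdn_gt0 n_gt0 m_dv_n.
rewrite -big_filter -[RHS]big_filter; apply: perm_big.
apply: uniq_perm; rewrite ?filter_uniq ?divisors_uniq // => d.
rewrite !mem_filter -!dvdn_divisors // -andbA; congr (_ && _).
by case: (boolP (d %| m)%N) => // /dvdn_trans ->.
Qed.

(** Only [p ^ a] divides [p ^ a] without dividing [p ^ (a - 1)], so the value is the quotient of
    these two powers. *)
Lemma Cyclotomic_at1_primepow (p a : nat) : prime p -> (0 < a)%N ->
  ('Phi_(p ^ a)).[1] = p%:R :> int.
Proof.
case: a => // a p_pr _; have p_gt1 := prime_gt1 p_pr; have p_gt0 := prime_gt0 p_pr.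
have pa_gt0 b : (0 < p ^ b)%N by rewrite expn_gt0 p_gt0.
have := prod_Cyclotomic_at1 _ (pa_gt0 a.+1).
rewrite (bigID (fun d => d %| p ^ a)%N) /= big_divisors_dvdn ?dvdn_exp2l //.
rewrite prod_Cyclotomic_at1 // -big_filter.
have -> : [seq d <- divisors (p ^ a.+1) | (d != 1%N) && ~~ (d %| p ^ a)%N] = [:: (p ^ a.+1)%N].
  apply: perm_small_eq => //; apply: uniq_perm; rewrite ?filter_uniq ?divisors_uniq // => d.
  rewrite mem_filter -dvdn_divisors // inE; apply/idP/eqP => [|->].
    case/andP=> /andP[_ ndv] /(dvdn_pfactor _ _ p_pr)[b b_le Ed].
    move: ndv; rewrite Ed dvdn_Pexp2l // -ltnNge => a_lt.
    by congr (p ^ _)%N; apply/eqP; rewrite eqn_leq b_le.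
  by rewrite dvdnn andbT dvdn_Pexp2l // ltnn andbT neq_ltn -{2}(exp1n a.+1) ltn_exp2r ?p_gt1 ?orbT.
rewrite big_seq1 expnSr natrM => /mulfI-> //.
by rewrite pnatr_eq0 -lt0n.
Qed.

(* The values at 1 of the Phi_d, d > 1 dividing q or m, already have product q m, and
   the remaining divisors d < q m are again products of two coprime numbers > 1. *)
Lemma Cyclotomic_at1_coprime (q m : nat) : (1 < q)%N -> (1 < m)%N -> coprime q m ->
  ('Phi_(q * m)).[1] = 1 :> int.
Proof.
have [n] := ubnP (q * m)%N; elim: n q m => // n IHn q m ltn q_gt1 m_gt1 co_qm.
have q_gt0 := ltnW q_gt1; have m_gt0 := ltnW m_gt1.
have qm_gt0 : (0 < q * m)%N by rewrite muln_gt0 q_gt0.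
have := prod_Cyclotomic_at1 _ qm_gt0.
rewrite (bigID (fun d => d %| q)%N) /= big_divisors_dvdn ?dvdn_mulr //.
have neq0 k : (0 < k)%N -> (k%:R : int) != 0 by rewrite pnatr_eq0 lt0n.
rewrite prod_Cyclotomic_at1 // natrM => /(mulfI (neq0 q q_gt0)).
rewrite (bigID (fun d => d %| m)%N) /=.
(* By coprimality, a divisor of m other than 1 cannot divide q. *)
rewrite [X in X * _](eq_bigl (fun d => (d != 1%N) && (d %| m)%N)); last first.
  move=> d; case: (boolP (d %| m)%N); rewrite ?andbF // !andbT => dm.
  apply/andb_idr=> d1; apply: contra d1 => dq.
  by rewrite -dvdn1 -(eqP co_qm) dvdn_gcd dq.
rewrite big_divisors_dvdn ?dvdn_mull // prod_Cyclotomic_at1 //.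
 rewrite -[X in _ = X -> _]mulr1 => /(mulfI (neq0 m m_gt0)).
rewrite -big_filter (bigD1_seq (q * m)%N) ?filter_uniq ?divisors_uniq //=; last first.
  rewrite mem_filter -dvdn_divisors // dvdnn andbT -andbA; apply/and3P; split.
  - by rewrite neq_ltn (leq_trans q_gt1) ?orbT // leq_pmulr.
  - by rewrite gtnNdvd // -[ltnLHS]muln1 ltn_pmul2l.
  - by rewrite gtnNdvd // -[ltnLHS]mul1n ltn_pmul2r.
rewrite big_seq_cond big1 ?mulr1 // => d.
rewrite mem_filter -dvdn_divisors // => /andP[/andP[/andP[/andP[d1 ndq] ndm] d_dv] d_neq].
have d_gt0 := dvdn_gt0 qm_gt0 d_dv.
have co_g : coprime (gcdn d q) (gcdn d m).
  exact: coprime_dvdl (dvdn_gcdr _ _) (coprime_dvdr (dvdn_gcdr _ _) co_qm).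
have Ed : d = (gcdn d q * gcdn d m)%N.
  apply/eqP; rewrite eqn_dvd Gauss_dvd ?dvdn_gcdl ?andbT //.
  by rewrite muln_gcdl dvdn_gcd dvdn_mulr // muln_gcdr dvdn_gcd dvdn_mull.
rewrite Ed; apply: IHn.
- rewrite -Ed -ltnS; apply: leq_trans ltn; rewrite ltnS.
  by rewrite ltn_neqAle d_neq dvdn_leq.
- rewrite ltn_neqAle eq_sym gcdn_gt0 d_gt0 andbT.
  by apply: contra ndm => /eqP g1; rewrite -(Gauss_dvdr _ (_ : coprime d q)) // /coprime g1.
- rewrite ltn_neqAle eq_sym gcdn_gt0 d_gt0 andbT.
  by apply: contra ndq => /eqP g1; rewrite -(Gauss_dvdl _ (_ : coprime d m)) // /coprime g1.
- exact: co_g.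
Qed.

(** For p the least prime factor of n, the p-part of n and its cofactor are coprime, and the
    cofactor exceeds 1 since n is no power of p. *)
Lemma Cyclotomic_at1_not_primepow (n : nat) : (1 < n)%N ->
  (forall p a : nat, prime p -> (0 < a)%N -> n <> (p ^ a)%N) ->
  ('Phi_n).[1] = 1 :> int.
Proof.
move=> n_gt1 npp; have n_gt0 := ltnW n_gt1.
have p_pr := pdiv_prime n_gt1; set p := pdiv n in p_pr.
have l_gt0 : (0 < logn p n)%N by rewrite logn_gt0 mem_primes p_pr n_gt0 pdiv_dvd.
rewrite -(partnC p n_gt0); apply: Cyclotomic_at1_coprime; last exact: coprime_partC.
  by rewrite p_part -(exp1n (logn p n)) ltn_exp2r ?prime_gt1.
rewrite ltn_neqAle eq_sym part_gt0 andbT; apply/eqP=> p'1.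
by apply: (npp p (logn p n)) => //; rewrite -p_part -[LHS](partnC p n_gt0) p'1 muln1.
Qed.

(** * Discriminants as products over ordered pairs *)

(** Each unordered pair of roots occurs twice on the right, with opposite differences, and so
    contributes minus a square. *)
Lemma disc_prod_XsubC {I : eqType} (J : seq I) (f : I -> algC) :
  uniq J -> {in J &, injective f} ->
  disc (\prod_(j <- J) ('X - (f j)%:P)) =
  (-1) ^+ 'C(size J, 2) * \prod_(j <- J) \prod_(k <- J | k != j) (f j - f k).
Proof.
move=> uJ f_inj.
have -> : \prod_(j <- J) \prod_(k <- J | k != j) (f j - f k)
        = \prod_(x <- map f J) \prod_(y <- map f J | y != x) (x - y).
  rewrite big_map; apply: eq_big_seq => j jJ; rewrite big_map.
  rewrite big_seq_cond [RHS]big_seq_cond; apply: eq_bigl => k.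
  by apply: andb_id2l => kJ; rewrite (inj_in_eq f_inj).
have us : uniq (map f J) by rewrite map_inj_in_uniq.
rewrite -(big_map f xpredT (fun x => 'X - x%:P)) -(size_map f).
move: (map f J) us => s us {J uJ f_inj}.
(* [croots] lists the roots in an unknown order, but the product over ordered pairs is invariant
   under permutation. *)
rewrite /disc /croots; case: closed_field_poly_normal => r /= Er.
move: Er; rewrite (monicP (monic_prod_XsubC _ _ _)) scale1r => /prod_XsubC_eq s_r.
have ur : uniq r by rewrite -(perm_uniq s_r).
rewrite (perm_size s_r) (perm_big _ s_r) /=.
under [in RHS]eq_bigr do rewrite (perm_big _ s_r) /=.
rewrite (big_nth 0) big_mkord.
under [in RHS]eq_bigr => i _ do
  rewrite (big_nth 0) big_mkord (bigID (fun j : 'I__ => (i < j)%N)) /=.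
rewrite big_split /=.
have -> : \prod_(i < size r) \prod_(j < size r | (r`_j != r`_i) && ~~ (i < j)%N) (r`_i - r`_j)
    = \prod_(i < size r) \prod_(j < size r | (i < j)%N) (r`_j - r`_i).
  rewrite (exchange_big_dep xpredT) //=; apply: eq_bigr => i _; apply: eq_bigl => j.
  by rewrite nth_uniq // -leqNgt [RHS]ltn_neqAle eq_sym.
have -> : (-1) ^+ 'C(size r, 2) = \prod_(i < size r) \prod_(j < size r | (i < j)%N) (-1) :> algC.
  rewrite (exchange_big_dep xpredT) //= -bin2_sum big_mkord -prodrXr.
  apply: eq_bigr => j _.
  by rewrite -(big_ord_widen _ (fun=> -1)) ?prodr_const ?card_ord // ltnW.
rewrite -!big_split; apply: eq_bigr => i _.
rewrite /=.
rewrite [X in _ = _ * (X * _)](eq_bigl (fun j : 'I__ => (i < j)%N)); last first.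
  move=> j; apply/andb_idl => ij; rewrite nth_uniq //.
  by rewrite neq_ltn ij orbT.
by rewrite -!big_split; apply: eq_bigr => j _ /=; ring.
Qed.

(** * Fibonacci polynomials and their complex roots *)

Lemma fibpoly_size_monic (m : nat) :
  size (fibpoly m.+1) = m.+1 /\ fibpoly m.+1 \is monic.
Proof.
(* The size of [fibpoly m] joins the induction to show that the added term does not reach the
   leading coefficient. *)
suff [] : (size (fibpoly m.+1) = m.+1 /\ fibpoly m.+1 \is monic) /\ size (fibpoly m) = m by [].
elim: m => [|m [[szS monS] sz]].
  by rewrite /= size_poly1 size_poly0 monic1.
have sz' : size (fibpoly m.+1 * 'X) = m.+2 by rewrite size_mulX ?monic_neq0 // szS.
have -> : fibpoly m.+2 = fibpoly m.+1 * 'X + fibpoly m by rewrite mulrC.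
have lt : (size (fibpoly m) < size (fibpoly m.+1 * 'X)%R)%N by rewrite sz sz' ltnS leqnSn.
by rewrite size_polyDl // monicE lead_coefDl // lead_coefMX (monicP monS).
Qed.

(** Binet's formula without denominator: y and -1/y are the roots of [T^2 = x T + 1] for
    [x = y - 1/y], so their powers obey the Fibonacci recurrence. *)
Lemma fibpoly_subV (m : nat) (y : algC) : y != 0 ->
  (y + y^-1) * (map_poly ratr (fibpoly m)).[y - y^-1] = y ^+ m - (- y^-1) ^+ m.
Proof.
move=> y0.
suff [] : (y + y^-1) * (map_poly ratr (fibpoly m)).[y - y^-1] = y ^+ m - (- y^-1) ^+ m /\
  (y + y^-1) * (map_poly ratr (fibpoly m.+1)).[y - y^-1] = y ^+ m.+1 - (- y^-1) ^+ m.+1 by [].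
elim: m => [|m [IH0 IH1]].
  by rewrite /= rmorph0 rmorph1 !hornerE; split; ring.
split=> //.
have -> : fibpoly m.+2 = 'X * fibpoly m.+1 + fibpoly m by [].
rewrite rmorphD rmorphM /= map_polyX !hornerE mulrDr IH0 mulrCA IH1 !exprS.
by field.
Qed.

(** As [y + 1/y] is nonzero, Binet's formula reduces the root condition to [y^m = (-1/y)^m];
    multiply by [(-y)^m]. *)
Lemma root_fibpoly (m : nat) (y : algC) : y != 0 -> - y ^+ 2 != 1 ->
  root (map_poly ratr (fibpoly m)) (y - y^-1) = ((- y ^+ 2) ^+ m == 1).
Proof.
move=> y0 y1; have yV0 : y + y^-1 != 0.
  apply: contra y1 => /eqP/(congr1 (fun t => y * t)); rewrite mulr0 mulrDr mulfV // => E.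
  by rewrite -expr2 in E; rewrite (canRL (addrK _) E) add0r opprK.
rewrite rootE -(inj_eq (mulfI yV0)) mulr0 fibpoly_subV // subr_eq0.
have yN0 : (- y) ^+ m != 0 by rewrite expf_neq0 // oppr_eq0.
by rewrite -(inj_eq (mulfI yN0)) -!exprMn mulrNN mulfV // expr1n mulNr.
Qed.

Definition coprimes (n : nat) : seq nat := [seq k <- index_iota 1 n | coprime k n].

(** For w = exp(i pi / n) this is 2 i cos(k pi / n). *)
Definition fibroot (w : algC) (k : nat) : algC := 'i * (w ^+ k + w ^- k).

Section Roots.
Variables (n : nat) (w : algC).
Hypotheses (n_gt1 : (1 < n)%N) (w_prim : (2 * n).-primitive_root w).

Let w_neq0 k : w ^+ k != 0.
Proof. by rewrite expf_neq0 // (prim_root_eq0 w_prim) muln_eq0; case: n n_gt1. Qed.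

Let i_neq0 : 'i != 0 :> algC. Proof. exact: neq0Ci. Qed.

Lemma primitive_sqr : n.-primitive_root (w ^+ 2).
Proof.
have := dvdn_prim_root w_prim (dvdn_mull 2 (dvdnn n)).
by rewrite mulnK // ltnW.
Qed.

Lemma primitive_exp_half : w ^+ n = -1.
Proof.
have := prim_expr_order w_prim; rewrite mulnC exprM => /eqP.
rewrite sqrf_eq1 => /orP[|/eqP //].
by rewrite -(prim_order_dvd w_prim) => /(dvdn_leq (ltnW n_gt1)) le_n; exfalso; lia.
Qed.

Lemma fibrootB j k : fibroot w j - fibroot w k =
  'i / (w ^+ j * w ^+ k) * ((w ^+ j - w ^+ k) * (w ^+ (j + k) - 1)).
Proof. by rewrite /fibroot exprD; field; rewrite !w_neq0. Qed.

(** In the factored difference, [w^j = w^k] forces j = k, while [w^(j+k) = 1] is impossible for 0 <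
    j + k < 2n. *)
Lemma fibroot_inj : {in index_iota 1 n &, injective (fibroot w)}.
Proof.
move=> j k; rewrite !mem_index_iota => /andP[j0 jn] /andP[k0 kn] /eqP.
rewrite -subr_eq0 fibrootB !mulf_eq0 invr_eq0 mulf_eq0 (negPf i_neq0) !(negPf (w_neq0 _)) /=.
rewrite !subr_eq0 (eq_prim_root_expr w_prim) -(prim_order_dvd w_prim).
case/orP=> [|/dvdn_leq le_jk]; last by have := le_jk; lia.
by rewrite !modn_small; [move/eqP | lia | lia].
Qed.

(** For [y = i w^k] one has [x_k = y - 1/y] and [-y^2 = (w^2)^k], which the bounds on k keep away
    from 1. *)
Lemma root_fibpoly_fibroot m k : (0 < k < n)%N ->
  root (map_poly ratr (fibpoly m)) (fibroot w k) = (n %| k * m)%N.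
Proof.
move=> k_bd; set y := 'i * w ^+ k.
have y0 : y != 0 by rewrite mulf_neq0.
have y2 : - y ^+ 2 = (w ^+ 2) ^+ k by rewrite exprMn sqrCi mulN1r opprK -!exprM mulnC.
have -> : fibroot w k = y - y^-1.
  by rewrite /fibroot /y invfM invCi mulrDr mulNr opprK.
rewrite root_fibpoly // y2; first by rewrite -[_ ^+ m]exprM -(prim_order_dvd primitive_sqr).
by case/andP: k_bd => k_gt0 k_n; rewrite -(prim_order_dvd primitive_sqr) gtnNdvd.
Qed.

(** The n - 1 known roots are distinct and match the degree. *)
Lemma fibpoly_prod :
  map_poly ratr (fibpoly n) = \prod_(k <- index_iota 1 n) ('X - (fibroot w k)%:P).
Proof.
have [szF monF] := fibpoly_size_monic n.-1.
rewrite (ltn_predK n_gt1) in szF monF.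
rewrite -(big_map (fibroot w) xpredT (fun x => 'X - x%:P)).
rewrite [LHS](@all_roots_prod_XsubC _ _ (map (fibroot w) (index_iota 1 n))).
- by rewrite (monicP _) ?scale1r // map_monic.
- by rewrite size_map_poly szF size_map size_iota subn1 (ltn_predK n_gt1).
- apply/allP=> x /mapP[k]; rewrite mem_index_iota => k_bd ->.
  by rewrite root_fibpoly_fibroot // dvdn_mull.
- by rewrite uniq_rootsE map_inj_in_uniq ?iota_uniq //; apply: fibroot_inj.
Qed.

End Roots.

(** * Rational irreducible factors and the roots of [fibotomic n] *)

(** For irreducibility, let p = r q. If x is a root of r, then p divides r and q is constant;
    otherwise p divides q and they are associates. *)
Lemma minCpoly_rat (x : algC) : exists p : {poly rat},
  [/\ p \is monic, irreducible_poly p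
    & forall q : {poly rat}, root (map_poly ratr q) x = (p %| q)].
Proof.
have [p [_ p_mon p_dv]] := minCpolyP x; exists p; split=> //.
have px : root (map_poly ratr p) x by rewrite p_dv.
have p0 := monic_neq0 p_mon.
split=> [|q szq /dvdpP[r Ep]].
  rewrite ltnNge; apply/negP=> /size1_polyC Ep.
  move: px p0; rewrite Ep map_polyC rootC fmorph_eq0 => /eqP->.
  by rewrite eqxx.
have rq0 : r * q != 0 by rewrite -Ep.
have [r0 q0] : r != 0 /\ q != 0 by move: rq0; rewrite mulf_eq0 negb_or => /andP[].
move: px; rewrite Ep rmorphM rootM !p_dv => /orP[/(dvdp_leq r0)|p_q].
  rewrite Ep size_mul // -ltnS prednK ?addn_gt0 ?size_poly_gt0 ?r0 //.
  rewrite -[X in (_ <= X)%N]addn1 leq_add2l => q_le1.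
  by case/negP: szq; rewrite eqn_leq q_le1 size_poly_gt0.
by rewrite /eqp -Ep p_q Ep dvdp_mull.
Qed.

(** Distinct monic irreducible polynomials are coprime, so their divisibilities combine one at a
    time. *)
Lemma irreducible_dvdp_prod (s : seq {poly rat}) (p : {poly rat}) :
  uniq s -> (forall q, q \in s -> [/\ q \is monic, irreducible_poly q & q %| p]) ->
  \prod_(q <- s) q %| p.
Proof.
elim: s => [|q s IHs] /=; first by rewrite big_nil dvd1p.
case/andP=> q_s us sP; have [q_mon q_irr q_p] := sP q (mem_head _ _).
have sP' r : r \in s -> [/\ r \is monic, irreducible_poly r & r %| p].
  by move=> rs; apply: sP; rewrite inE rs orbT.
rewrite big_cons Gauss_dvdp ?q_p ?IHs //.
rewrite big_seq; apply: (big_ind (coprimep q)) => [|r t cr ct|r rs].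
- exact: coprimep1.
- by rewrite coprimepMr cr.
have [r_mon [_ r_irr] _] := sP' r rs.
rewrite irreducible_poly_coprime //; apply: contra q_s => qr.
have := r_irr q _ qr; rewrite eqp_monic // => /(_ _)/eqP-> //.
by case: q_irr; rewrite ltn_neqAle eq_sym => /andP[].
Qed.

Lemma prod_mem_monic (s : seq {poly rat}) :
  (forall q, q \in s -> q \is monic) -> \prod_(q <- s) q \is monic.
Proof. by move=> sP; rewrite big_seq; apply: rpred_prod => q /sP. Qed.

Section Fibotomic.
Variables (n : nat) (w : algC).
Hypotheses (n_gt1 : (1 < n)%N) (w_prim : (2 * n).-primitive_root w).

(** As q is the minimal polynomial of x_k up to a unit, it divides F_m iff x_k is a root of F_m. *)
Lemma fibroot_dvdp_minimal k (q : {poly rat}) : (0 < k < n)%N ->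
  irreducible_poly q -> root (map_poly ratr q) (fibroot w k) ->
  (forall m, (0 < m < n)%N -> ~~ (q %| fibpoly m)) <-> coprime k n.
Proof.
move=> k_bd q_irr qk.
have qP p : root (map_poly ratr p) (fibroot w k) = (q %| p).
  have [p0 [p0_mon p0_irr p0P]] := minCpoly_rat (fibroot w k).
  rewrite p0P; apply: eqp_dvdl; apply: q_irr; last by rewrite -p0P.
  by case: p0_irr; rewrite ltn_neqAle eq_sym => /andP[].
have n_gt0 := ltnW n_gt1.
split=> [q_min | co_kn m m_bd]; last first.
  rewrite -qP (root_fibpoly_fibroot _ _ n_gt1 w_prim) // Gauss_dvdr 1?coprime_sym //.
  by rewrite gtnNdvd //; lia.
have g_gt0 : (0 < gcdn k n)%N by rewrite gcdn_gt0 n_gt0 orbT.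
case: (posnP (gcdn k n).-1) => [g1 | g_gt1]; first by rewrite /coprime; lia.
have m_bd : (0 < n %/ gcdn k n < n)%N.
  by rewrite divn_gt0 // dvdn_leq ?dvdn_gcdr // ltn_Pdiv //; lia.
have := q_min _ m_bd; rewrite -qP (root_fibpoly_fibroot _ _ n_gt1 w_prim) //.
by rewrite muln_divCA_gcd dvdn_mulr.
Qed.

(** The choice by [epsilon] in [fibotomic] is meaningful only if such a list exists. The minimal
    polynomials of the x_k with k coprime to n form one; conjugate roots share theirs, hence
    [undup]. *)
Lemma fibotomic_factors_ex : exists s, fibotomic_factors n s.
Proof.
have /fin_all_exists[f fP] (k : 'I_n) := minCpoly_rat (fibroot w k).
exists (undup (map f [seq k : 'I_n <- enum 'I_n | coprime k n])); split; first exact: undup_uniq.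
have n_gt0 := ltnW n_gt1.
have co_bd k : (k < n)%N -> coprime k n -> (0 < k < n)%N.
  by case: k => // _; rewrite /coprime gcd0n; lia.
move=> q; rewrite mem_undup; split.
  case/mapP=> k; rewrite mem_filter => /andP[co_k _] ->.
  have [f_mon f_irr f_dv] := fP k; have k_bd := co_bd k (ltn_ord k) co_k.
  split=> //; first by rewrite -f_dv (root_fibpoly_fibroot _ _ n_gt1 w_prim) // dvdn_mull.
  by apply/(fibroot_dvdp_minimal _ _ k_bd); rewrite ?f_dv.
case=> q_mon q_irr q_dv q_min.
(* A complex root of q is a root of [fibpoly n], hence some x_k, and q is the minimal polynomial of
   x_k. *)
have [x qx] : exists x, root (map_poly ratr q : {poly algC}) x.
  apply: closed_rootP; rewrite size_map_poly.
  by case: q_irr; rewrite ltn_neqAle eq_sym => /andP[].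
have : root (map_poly ratr (fibpoly n)) x.
  by rewrite -dvdp_XsubCl (dvdp_trans _ (_ : map_poly ratr q %| _)) ?dvdp_XsubCl ?dvdp_map.
rewrite (fibpoly_prod _ _ n_gt1 w_prim).
rewrite -(big_map (fibroot w) xpredT (fun x => 'X - x%:P)) root_prod_XsubC.
case/mapP=> k; rewrite mem_index_iota => k_bd Ex; rewrite Ex in qx.
have k_n : (k < n)%N by case/andP: k_bd.
have [f_mon f_irr f_dv] := fP (Ordinal k_n).
apply/mapP; exists (Ordinal k_n).
  rewrite mem_filter mem_enum andbT; exact/(fibroot_dvdp_minimal _ _ k_bd q_irr qx).
apply/eqP; rewrite -eqp_monic // eqp_sym; apply: q_irr.2; last by rewrite -f_dv.
by case: f_irr; rewrite ltn_neqAle eq_sym => /andP[].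
Qed.

Lemma fibotomic_prod : map_poly ratr (fibotomic n) =
  \prod_(k <- coprimes n) ('X - (fibroot w k)%:P).
Proof.
rewrite /fibotomic leqNgt n_gt1 /=.
have := ClassicalEpsilon.epsilon_spec (inhabits [::]) _ fibotomic_factors_ex.
set s := ClassicalEpsilon.epsilon _ _ => -[us sP].
have Fs : \prod_(q <- s) q %| fibpoly n.
  by apply: irreducible_dvdp_prod => // q /sP[].
have s_mon : \prod_(q <- s) q \is monic by apply: prod_mem_monic => q /sP[].
have := Fs; rewrite -(dvdp_map (ratr : {rmorphism rat -> algC})) (fibpoly_prod _ _ n_gt1 w_prim).
(* A monic divisor of a product of linear factors is a subproduct, given by the mask m; it remains
   to see which k the mask keeps. *)
case/dvdp_prod_XsubC => m; rewrite eqp_monic ?map_monic ?monic_prod_XsubC // => /eqP Em.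
rewrite Em; apply: perm_big; apply: uniq_perm.
- by rewrite mask_uniq // iota_uniq.
- by rewrite filter_uniq // iota_uniq.
move=> k; rewrite mem_filter.
have [k_r | k_r] := boolP (k \in index_iota 1 n); last first.
  by rewrite andbF; apply: contraNF k_r; apply: mem_mask.
rewrite andbT; have k_bd : (0 < k < n)%N by rewrite -mem_index_iota.
transitivity (root (map_poly ratr (\prod_(q <- s) q)) (fibroot w k)).
  rewrite Em -(big_map (fibroot w) xpredT (fun x => 'X - x%:P)) root_prod_XsubC.
  apply/idP/mapP => [km | [l lm /(fibroot_inj _ _ n_gt1 w_prim)->]] //; first by exists k.
  exact: mem_mask lm.
rewrite -[LHS]negbK rmorph_prod /= -(big_map (map_poly ratr) xpredT id) root_bigmul all_map.
rewrite -has_predC; apply/hasP/idP => /= [[q qs]|co_kn].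
  rewrite negbK => qk; have [_ q_irr _ q_min] := (sP q).1 qs.
  exact/(fibroot_dvdp_minimal _ _ k_bd q_irr qk).
have [q [q_mon q_irr q_dv]] := minCpoly_rat (fibroot w k).
have qk : root (map_poly ratr q) (fibroot w k) by rewrite q_dv.
exists q; last by rewrite negbK.
apply/sP; split=> //; last exact/(fibroot_dvdp_minimal _ _ k_bd q_irr qk).
by rewrite -q_dv (root_fibpoly_fibroot _ _ n_gt1 w_prim) // dvdn_mull.
Qed.
End Fibotomic.

(** * Products over pairs of residues coprime to n *)

Definition offdiag (J : seq nat) (F : nat -> nat -> algC) : algC :=
  \prod_(j <- J) \prod_(k <- J | k != j) F j k.

Lemma eq_offdiag J F G : F =2 G -> offdiag J F = offdiag J G.
Proof. by move=> FG; apply: eq_bigr => j _; apply: eq_bigr => k _; apply: FG. Qed.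

Lemma offdiagM J F G :
  offdiag J (fun j k => F j k * G j k) = offdiag J F * offdiag J G.
Proof. by rewrite -big_split; apply: eq_bigr => j _; rewrite big_split. Qed.

Lemma offdiagD J F : uniq J ->
  \prod_(j <- J) \prod_(k <- J) F j k = offdiag J F * \prod_(j <- J) F j j.
Proof.
move=> uJ; rewrite -big_split; apply: eq_big_seq => j jJ /=.
by rewrite (bigD1_seq j) //= mulrC.
Qed.

Section Ratio.
Variables (n : nat) (w : algC).
Hypotheses (n_gt1 : (1 < n)%N) (w_prim : (2 * n).-primitive_root w).

Let J := coprimes n.
Let d := size J.

Let J_uniq : uniq J. Proof. by rewrite filter_uniq ?iota_uniq. Qed.

Let J_bound j : j \in J -> (0 < j < n)%N.
Proof. by rewrite mem_filter mem_index_iota => /andP[]. Qed.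

Let w_neq0 k : w ^+ k != 0.
Proof. by rewrite expf_neq0 // (prim_root_eq0 w_prim) muln_eq0; case: n n_gt1. Qed.

Lemma size_coprimes : d = totient n.
Proof.
rewrite /d size_filter totient_count_coprime big_ltn ?(ltnW n_gt1) //.
rewrite /coprime gcdn0 gtn_eqF // add0n -sum1_count big_mkcond /=.
by apply: eq_bigr => k _; rewrite gcdnC; case: eqP.
Qed.

Lemma coprimes_rev : perm_eq J [seq (n - j)%N | j <- J].
Proof.
have rev_J j : j \in J -> (n - j)%N \in J.
  move=> jJ; have j_bd := J_bound _ jJ; move: jJ.
  rewrite !mem_filter !mem_index_iota => /andP[co_j _]; apply/andP; split; last by lia.
  have En : n = (n - j + j)%N by lia.
  by move: co_j; rewrite /coprime {1 3}En gcdnDr gcdnDl gcdnC.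
apply: uniq_perm => //.
  rewrite map_inj_in_uniq // => j k /J_bound j_bd /J_bound k_bd; lia.
move=> j; apply/idP/mapP => [jJ | [k kJ ->]]; last exact: rev_J.
by exists (n - j)%N; [exact: rev_J | have := J_bound _ jJ; lia].
Qed.

(** Pair j with n - j. The sum is the exponent of w in the product [W] below. *)
Lemma sum_coprimes : (2 * \sum_(j <- J) j = n * d)%N.
Proof.
rewrite mul2n -addnn [X in (X + _)%N](perm_big _ coprimes_rev) big_map -big_split.
rewrite (eq_big_seq (fun=> n)); last by move=> j /J_bound /= j_bd; lia.
by rewrite big_const_seq count_predT iter_addn_0.
Qed.

Let W := \prod_(j <- J) w ^+ j.

Let prod_const_J (c : algC) : \prod_(j <- J) c = c ^+ d.
Proof. by rewrite big_const_seq count_predT iter_mulr_1. Qed.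

(** After reflecting j to n - j, use [w^j (w^(n-j) + w^k) = w^(j+k) - 1]. Each [w^j] is spent once
    for every k, hence [W^d]. *)
Lemma prod_add_coprimes :
  W ^+ d * \prod_(j <- J) \prod_(k <- J) (w ^+ j + w ^+ k)
  = \prod_(j <- J) \prod_(k <- J) (w ^+ (j + k) - 1).
Proof.
rewrite (perm_big _ coprimes_rev) big_map /= -prodrXl -big_split.
apply: eq_big_seq => j /J_bound j_bd /=; rewrite -prod_const_J -big_split.
apply: eq_bigr => k _ /=; rewrite mulrDr -!exprD subnKC; last by lia.
by rewrite (primitive_exp_half _ _ n_gt1 w_prim) addrC.
Qed.

(** The units left over in the comparison cancel, but only after a case analysis
    on the parity of d: W is fixed up to sign by W^2 = (-1)^d, which is enough
    when d is odd, whereas W = (w^n)^(d/2) when d is even. *)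
Lemma offdiag_sign :
  offdiag J (fun j k => 'i / (w ^+ j * w ^+ k)) * W ^+ d.+1 * (-1) ^+ d = 1.
Proof.
set C := offdiag _ _.
(* C is found by comparing the full product over all pairs with the diagonal one; both are powers of
   ['i] over powers of W. *)
have := offdiagD _ (fun j k => 'i / (w ^+ j * w ^+ k)) J_uniq; rewrite -/C.
have -> : \prod_(j <- J) ('i / (w ^+ j * w ^+ j)) = 'i ^+ d / W ^+ 2.
  by rewrite big_split /= prodfV big_split /= prod_const_J -expr2.
have -> : \prod_(j <- J) \prod_(k <- J) ('i / (w ^+ j * w ^+ k)) = 'i ^+ (d * d) / (W ^+ 2) ^+ d.
  under eq_bigr do rewrite big_split /= prodfV big_split /= !prod_const_J -/W.
  by rewrite big_split /= prodfV big_split /= !prod_const_J prodrXl -/W exprM expr2 exprMn.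
have EW : W = w ^+ (\sum_(j <- J) j) by rewrite /W prodrXr.
have wn := primitive_exp_half _ _ n_gt1 w_prim.
have W2 : W ^+ 2 = (-1) ^+ d by rewrite EW -exprM mulnC sum_coprimes exprM wn.
rewrite W2; have := odd_double_half d; set e := d./2; case: (odd d) => /= Ed H.
- have sgn_d : (-1) ^+ d = -1 :> algC by rewrite -signr_odd -Ed /= odd_double.
  have id : 'i ^+ d = 'i * (-1) ^+ e :> algC by rewrite -Ed exprS -mul2n exprM sqrCi.
  have id0 : 'i ^+ d / -1 != 0 :> algC.
    by rewrite mulf_neq0 ?expf_neq0 ?neq0Ci // invr_eq0 oppr_eq0 oner_eq0.
  have idd : 'i ^+ (d * d) = (-1) ^+ e * 'i ^+ d :> algC.
    by rewrite exprM {1}id exprMn mulrC exprAC sgn_d.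
  move: H; rewrite !sgn_d idd -[_ * _ / -1]mulrA => /(mulIf id0) <-.
  have -> : W ^+ d.+1 = - (-1) ^+ e.
    by rewrite (_ : d.+1 = 2 * e.+1)%N ?exprM ?W2 ?sgn_d ?exprS ?mulN1r //; lia.
  by rewrite mulrN1 mulrN opprK -expr2 sqrr_sign.
- have sgn_d : (-1) ^+ d = 1 :> algC by rewrite -signr_odd -Ed odd_double.
  have id : 'i ^+ d = (-1) ^+ e :> algC by rewrite -Ed -mul2n exprM sqrCi.
  have sd : ((-1) ^+ e) ^+ d = 1 :> algC by rewrite exprAC sgn_d expr1n.
  have Ws : W = (-1) ^+ e by rewrite EW -wn -exprM; congr (_ ^+ _); have := sum_coprimes; nia.
  move: H; rewrite sgn_d expr1n exprM id sd !divr1 Ws exprS sd !mulr1 => <-.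
  by [].
Qed.

(** The ratio of the discriminants in cross-multiplied form, which postpones the question of
    nonvanishing. *)
Lemma offdiag_fibroot_zeta :
  offdiag J (fun j k => fibroot w j - fibroot w k) * \prod_(k <- J) (1 - (w ^+ 2) ^+ k)
  = offdiag J (fun j k => (w ^+ 2) ^+ j - (w ^+ 2) ^+ k) * 2 ^+ d.
Proof.
rewrite (eq_offdiag _ _ _ (fibrootB _ _ n_gt1 w_prim)).
rewrite (offdiagM J (fun j k => 'i / (w ^+ j * w ^+ k))) (offdiagM J (fun j k => w ^+ j - w ^+ k)).
rewrite (eq_offdiag _ (fun j k => (w ^+ 2) ^+ j - _)
                      (fun j k => (w ^+ j - w ^+ k) * (w ^+ j + w ^+ k)));
  last by move=> j k; rewrite -!exprM mulnC [(2 * k)%N]mulnC !exprM -subr_sqr.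
rewrite (offdiagM J (fun j k => w ^+ j - w ^+ k)).
have -> : \prod_(k <- J) (1 - (w ^+ 2) ^+ k) = (-1) ^+ d * \prod_(k <- J) (w ^+ (k + k) - 1).
  rewrite -prod_const_J -big_split; apply: eq_bigr => k _ /=.
  by rewrite -exprM mul2n addnn mulN1r opprB.
have := prod_add_coprimes; rewrite !offdiagD //.
(* These diagonal terms are the source of the power of 2. *)
have -> : \prod_(j <- J) (w ^+ j + w ^+ j) = 2 ^+ d * W.
  by rewrite -prod_const_J -big_split; apply: eq_bigr => k _ /=; ring.
set M := offdiag _ _; set N := offdiag _ _; set C := offdiag _ _; set D := offdiag _ _.
set P := \prod_(k <- J) _ => NP.
have sgn : C * W ^+ d.+1 * (-1) ^+ d = 1 by exact: offdiag_sign.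
(* Trading N P for [W^d M 2^d W] leaves the unit [C W^(d+1) (-1)^d], which is 1. *)
transitivity ((C * D * (-1) ^+ d) * (N * P)); first by ring.
rewrite -NP -[RHS]mulr1 -[X in _ = _ * X]sgn (exprS W); ring.
Qed.
End Ratio.

(** * The ratio of the discriminants *)

Lemma Cyclotomic_prod (n : nat) (z : algC) : (1 < n)%N -> n.-primitive_root z ->
  map_poly intr 'Phi_n = \prod_(k <- coprimes n) ('X - (z ^+ k)%:P).
Proof.
move=> n_gt1 /Cintr_Cyclotomic->; rewrite /cyclotomic.
rewrite big_filter -(big_mkord (fun k => coprime k n) (fun k => 'X - (z ^+ k)%:P)).
by rewrite big_ltn_cond ?(ltnW n_gt1) // /coprime gcd0n gtn_eqF.
Qed.

Lemma disc_fibotomic_Cyclotomic (n : nat) : (1 < n)%N ->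
  disc (map_poly ratr (fibotomic n)) / disc (map_poly intr 'Phi_n)
  = 2 ^+ totient n / (('Phi_n).[1])%:~R.
Proof.
move=> n_gt1; have n2_gt0 : (0 < 2 * n)%N by lia.
have [w w_prim] := C_prim_root_exists n2_gt0.
have z_prim := primitive_sqr _ _ n_gt1 w_prim.
have EPhi := Cyclotomic_prod _ _ n_gt1 z_prim.
have -> : (('Phi_n).[1])%:~R = \prod_(k <- coprimes n) (1 - (w ^+ 2) ^+ k) :> algC.
  rewrite -horner_map /= rmorph1 EPhi horner_prod.
  by apply: eq_bigr => k _; rewrite !hornerE.
rewrite EPhi (fibotomic_prod _ _ n_gt1 w_prim).
have := offdiag_fibroot_zeta _ _ n_gt1 w_prim; rewrite size_coprimes //.
set J := coprimes n.
have J_uniq : uniq J by rewrite filter_uniq ?iota_uniq.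
have J_bd j : j \in J -> (0 < j < n)%N by rewrite mem_filter mem_index_iota => /andP[].
have x_inj : {in J &, injective (fibroot w)}.
  by move=> j k /J_bd jn /J_bd kn; apply: (fibroot_inj _ _ n_gt1 w_prim); rewrite mem_index_iota.
have z_inj : {in J &, injective (fun k => (w ^+ 2) ^+ k)}.
  move=> j k /J_bd jn /J_bd kn /eqP; rewrite (eq_prim_root_expr z_prim).
  rewrite !modn_small; [by move/eqP | lia | lia].
rewrite !disc_prod_XsubC //.
rewrite -/(offdiag J (fun j k => fibroot w j - fibroot w k)).
rewrite -/(offdiag J (fun j k => (w ^+ 2) ^+ j - (w ^+ 2) ^+ k)).
set B := offdiag J (fun j k => _ ^+ j - _); set A := offdiag J _; set P := \prod_(k <- J) _ => E.
have B0 : B != 0.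
  rewrite prodf_seq_neq0; apply/allP=> j jJ; rewrite prodf_seq_neq0; apply/allP=> k kJ.
  apply/implyP; apply: contra; rewrite subr_eq0 => /eqP /z_inj-> //.
have P0 : P != 0.
  rewrite prodf_seq_neq0; apply/allP=> k /J_bd /andP[k_gt0 k_n] /=.
  by rewrite subr_eq0 eq_sym -(prim_order_dvd z_prim) gtnNdvd.
(* Both discriminants carry the same sign, as the two polynomials have equally many roots. *)
rewrite -mulf_div divff ?mul1r; last by rewrite expf_neq0 // oppr_eq0 oner_eq0.
by apply/eqP; rewrite eqr_div // E mulrC.
Qed.

Theorem mainTheorem7 (n : nat) (hn : (2 <= n)%N) :
  let ratio := disc (map_poly ratr (fibotomic n)) /
               disc (map_poly intr (Cyclotomic n)) : algC in
  (forall (p a : nat), prime p -> (0 < a)%N -> n = (p ^ a)%N ->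
     ratio = (2 ^+ totient n) / p%:R) /\
  ((forall (p a : nat), prime p -> (0 < a)%N -> n <> (p ^ a)%N) ->
     ratio = 2 ^+ totient n).
Proof.
move=> ratio; rewrite {}/ratio disc_fibotomic_Cyclotomic //; split=> [p a p_pr a_gt0 En | npp].
  by rewrite {2}En Cyclotomic_at1_primepow // mulrz_nat.
by rewrite Cyclotomic_at1_not_primepow // divr1.
Qed.
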